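(* $\delta_{\mathrm{np}}\geq \frac34$.
   Context: $F_2=F(a,b)$ is the free group of rank two with fixed basis $(a,b)$, and $B_n\subset F_2$ is the ball of radius $n$ in the word metric with respect to $\{a,b\}$. For $u,v\in F_2$, $\varphi_{u,v}\colon F_2\to F_2$ is the endomorphism with $a\mapsto u$, $b\mapsto v$. An endomorphism $\varphi\colon F_2\to F_2$ is called prime if it is injective and, whenever $\varphi=\alpha\circ\beta$ with endomorphisms $\alpha,\beta\colon F_2\to F_2$, at least one of $\alpha,\beta$ is an automorphism. Let $\mathcal N_n=\{(u,v)\in B_n\times B_n:\varphi_{u,v}\text{ is not prime}\}$ and $$\delta_{\mathrm{np}}=\limsup_{n\to\infty}\frac{\log|\mathcal N_n|}{\log|B_n\times B_n|}.$$ *)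

(* Defs.v *)
From HB Require Import structures.
From mathcomp Require Import all_boot all_order all_algebra.
From mathcomp Require Import finmap.
From mathcomp Require Import boolp classical_sets functions cardinality.
From mathcomp Require Import reals ereal topology normedtype sequences exp.

Set Implicit Arguments.
Unset Strict Implicit.
Unset Printing Implicit Defensive.

Local Open Scope group_scope.

(* The free group F_2 = F(a, b) is realized by the reduced words in the four  *)
(* letters a, b, a^-1, b^-1, multiplied by concatenation and free reduction.  *)
(* In a letter (c, e), c = true stands for a and c = false for b; e = true    *)
(* marks the inverse of the generator.                                        *)
Notation letter := (bool * bool)%type.

Definition linv (x : letter) : letter := (x.1, ~~ x.2).

Lemma linvK : involutive linv.
Proof. by case=> c []. Qed.

Definition reduced : pred (seq letter) := sorted (fun x y => y != linv x).

(* [push x w] is the reduced form of [x :: w] when [w] is reduced. *)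
Definition push (x : letter) (w : seq letter) : seq letter :=
  if w is y :: w' then if y == linv x then w' else x :: w else [:: x].

Definition reduce (w : seq letter) : seq letter := foldr push [::] w.

Lemma push_reduced x w : reduced w -> reduced (push x w).
Proof.
case: w => //= y w; case: eqP => [_|/eqP neq_yx] /=; first exact: path_sorted.
by rewrite neq_yx.
Qed.

Lemma foldr_push_reduced u w : reduced w -> reduced (foldr push w u).
Proof. by move=> redw; elim: u => //= x u; apply: push_reduced. Qed.

Lemma reduce_reduced w : reduced (reduce w).
Proof. exact: foldr_push_reduced. Qed.

Lemma reduce_id w : reduced w -> reduce w = w.
Proof.
rewrite /reduce; elim: w => //= x w IHw redxw.
rewrite IHw; last exact: path_sorted redxw.
by case: w redxw {IHw} => //= y w /andP[/negPf ->].
Qed.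

Lemma pushK x w : reduced w -> push (linv x) (push x w) = w.
Proof.
case: w => [|y w] /=; first by rewrite linvK eqxx.
case: eqP => [->|_]; last by rewrite /= linvK eqxx.
by case: w => //= z w /andP[/negPf ->].
Qed.

Lemma pushVK x w : reduced w -> push x (push (linv x) w) = w.
Proof. by rewrite -{1}[x]linvK; apply: pushK. Qed.

Lemma foldr_push_reduce u w :
  reduced w -> foldr push w (reduce u) = foldr push w u.
Proof.
move=> redw; elim: u => //= x u <-.
case: (reduce u) => //= y s; case: eqP => //= ->.
by rewrite pushVK ?foldr_push_reduced.
Qed.

Definition winv (w : seq letter) : seq letter := rev (map linv w).

Lemma foldr_push_winv u w :
  reduced w -> foldr push (foldr push w u) (winv u) = w.
Proof.
rewrite /winv => redw; elim: u => //= x u IHu.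
by rewrite rev_cons foldr_rcons pushK ?IHu ?foldr_push_reduced.
Qed.

Record F2 := MkF2 { word_of :> seq letter; word_ofP : reduced word_of }.

HB.instance Definition _ := [isSub for word_of].
HB.instance Definition _ := [Choice of F2 by <:].

Definition F2_of (w : seq letter) : F2 := MkF2 (reduce_reduced w).

Definition F2one : F2 := F2_of [::].
Definition F2mul (g h : F2) : F2 := F2_of (g ++ h).
Definition F2inv (g : F2) : F2 := F2_of (winv g).

Lemma F2mulA : associative F2mul.
Proof.
move=> g h k; apply: val_inj => /=.
rewrite {1}/reduce foldr_cat -/(reduce _) reduce_id ?reduce_reduced //.
rewrite -foldr_cat catA; symmetry.
by rewrite /reduce [LHS]foldr_cat foldr_push_reduce ?reduce_reduced ?foldr_cat.
Qed.

Lemma F2mul1 : left_id F2one F2mul.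
Proof. by move=> g; apply: val_inj; rewrite /= reduce_id ?word_ofP. Qed.

Lemma F2mulr1 : right_id F2one F2mul.
Proof. by move=> g; apply: val_inj; rewrite /= cats0 reduce_id ?word_ofP. Qed.

Lemma F2mulV : left_inverse F2one F2inv F2mul.
Proof.
move=> g; apply: val_inj; rewrite /= /reduce foldr_cat foldr_push_reduce.
  exact: foldr_push_winv.
exact: foldr_push_reduced.
Qed.

Lemma F2mulrV : right_inverse F2one F2inv F2mul.
Proof.
move=> g.
rewrite -[F2mul _ _]F2mul1 -{1}(F2mulV (F2inv g)) -F2mulA.
by rewrite (F2mulA (F2inv g)) F2mulV F2mul1 F2mulV.
Qed.

HB.instance Definition _ :=
  isGroup.Build F2 F2mulA F2mul1 F2mulr1 F2mulV F2mulrV.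

Definition gen_a : F2 := F2_of [:: (true, false)].
Definition gen_b : F2 := F2_of [:: (false, false)].

Definition letter_val (u v : F2) (x : letter) : F2 :=
  let g := if x.1 then u else v in if x.2 then g^-1 else g.

Definition word_val (u v : F2) (w : seq letter) : F2 :=
  \prod_(x <- w) letter_val u v x.

(* The endomorphism phi_{u,v}; see [phi_a], [phi_b] and [phi_unique]. *)
Definition phi (u v : F2) (g : F2) : F2 := word_val u v g.

Notation endomorphism := (UMagmaMorphism.type F2 F2).

Lemma letter_valV u v x : letter_val u v (linv x) = (letter_val u v x)^-1.
Proof. by case: x => c [] //; rewrite /letter_val /= invgK. Qed.

Lemma word_val_push u v x w :
  word_val u v (push x w) = letter_val u v x * word_val u v w.
Proof.
rewrite /word_val; case: w => [|y w] /=; first by rewrite big_cons.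
by case: eqP => [->|_]; rewrite !big_cons // letter_valV mulVKg.
Qed.

Lemma word_val_reduce u v w : word_val u v (reduce w) = word_val u v w.
Proof.
elim: w => //= x w IHw.
by rewrite word_val_push IHw /word_val big_cons.
Qed.

Lemma phiM u v (g h : F2) : phi u v (g * h) = phi u v g * phi u v h.
Proof. by rewrite /phi word_val_reduce /word_val big_cat. Qed.

Lemma phi1 u v : phi u v 1 = 1.
Proof. by rewrite /phi /word_val big_nil. Qed.

HB.instance Definition _ u v := isUMagmaMorphism.Build F2 F2 (phi u v)
  (conj (phi1 u v) (phiM u v)).

Lemma phi_a u v : phi u v gen_a = u.
Proof. by rewrite /phi /word_val big_seq1. Qed.

Lemma phi_b u v : phi u v gen_b = v.
Proof. by rewrite /phi /word_val big_seq1. Qed.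

Lemma word_val_gen w : word_val gen_a gen_b w = F2_of w.
Proof.
rewrite /word_val; elim: w => [|x w IHw]; first by rewrite big_nil.
rewrite big_cons IHw; apply: val_inj.
rewrite /= (_ : word_of (letter_val _ _ x) = [:: x]) /=; last by case: x => [[] []].
by rewrite reduce_id // reduce_reduced.
Qed.

Lemma F2_ofK (g : F2) : F2_of g = g.
Proof. by apply: val_inj; rewrite /= reduce_id ?word_ofP. Qed.

Lemma phi_unique (f : endomorphism) : f =1 phi (f gen_a) (f gen_b).
Proof.
move=> g; rewrite /phi -[g in LHS]F2_ofK -word_val_gen /word_val.
elim: (word_of g) => [|x w IHw]; first by rewrite !big_nil gmulf1.
rewrite !big_cons gmulfM IHw; congr (_ * _).
by case: x => [[] []]; rewrite /letter_val //= gmulfV.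
Qed.

Definition automorphism (f : endomorphism) : Prop := bijective f.

Definition prime_endo (f : endomorphism) : Prop :=
  injective f /\
  forall alpha beta : endomorphism, f =1 alpha \o beta ->
    automorphism alpha \/ automorphism beta.

Local Open Scope classical_set_scope.

(* Elements at word distance at most n from 1 with respect to {a, b}: values  *)
(* of (possibly non-reduced) words of length at most n in a, b, a^-1, b^-1.   *)
Definition F2ball (n : nat) : set F2 :=
  [set g | exists2 w : seq letter, (size w <= n)%N & g = word_val gen_a gen_b w].

Lemma size_reduce w : (size (reduce w) <= size w)%N.
Proof.
elim: w => //= x w IHw; apply: (@leq_trans (size (reduce w)).+1) => //.
case: (reduce w) => //= y s; case: ifP => //= _.
by rewrite -addn2 leq_addr.
Qed.

Lemma F2ballE n : F2ball n = [set g : F2 | (size g <= n)%N].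
Proof.
apply/seteqP; split=> [g [w le_wn ->]|g le_gn] /=.
  by rewrite word_val_gen; apply: leq_trans le_wn; apply: size_reduce.
by exists (word_of g) => //; rewrite word_val_gen F2_ofK.
Qed.

Lemma finite_F2ball n : finite_set (F2ball n).
Proof.
rewrite (_ : F2ball n = [set word_val gen_a gen_b w | w in [set: n.-bseq letter]]).
  exact/finite_image/finite_finset.
apply/seteqP; split=> [g [w le_wn ->]|_ [w _ <-]].
  by exists (Bseq le_wn).
by exists w => //; apply: size_bseq.
Qed.

Definition nonprime_pairs (n : nat) : set (F2 * F2) :=
  [set uv | (F2ball n `*` F2ball n) uv /\ ~ prime_endo (phi uv.1 uv.2)].

Lemma finite_nonprime_pairs n : finite_set (nonprime_pairs n).
Proof.
by apply: sub_finite_set (finite_setX (finite_F2ball n) (finite_F2ball n)) => uv [].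
Qed.

(* [fset_set] is meaningful only on finite sets; see [finite_F2ball] and      *)
(* [finite_nonprime_pairs].                                                   *)
Definition card_set (T : choiceType) (A : set T) : nat := #|` fset_set A|.

Definition delta_np (R : realType) : \bar R :=
  limn_esup (fun n => (ln ((card_set (nonprime_pairs n))%:R : R)
                       / ln ((card_set (F2ball n `*` F2ball n))%:R : R))%R%:E).

(* Main.v *)
(** If [u] has length [n] and [w] has length [n/2], with [n/2] even, then
    [phi u (w * w)] is the composite of [phi u w] with the substitution
    [a -> a, b -> b^2].  Neither factor is surjective, as two homomorphisms to
    [Z/2] show: the parity of the length kills the image of the first factor,
    and the parity of the number of letters [b] kills that of the second.  There
    are about [3^(n + n/2)] such pairs, against about [3^(2 n)] pairs in the
    square of the ball. *)

Require Import Defs.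
From mathcomp Require Import all_boot all_order all_algebra.
From mathcomp Require Import finmap.
From mathcomp Require Import boolp classical_sets functions cardinality.
From mathcomp Require Import reals ereal topology normedtype sequences exp.
From mathcomp Require Import zify ring lra.

Set Implicit Arguments.
Unset Strict Implicit.
Unset Printing Implicit Defensive.

Import Order.TTheory GRing.Theory Num.Theory.

(** * Counting by maps from finite types *)

Lemma card_set_ge (T : finType) (U : choiceType) (f : T -> U) (A : set U) :
  finite_set A -> injective f -> (forall x, A (f x)) -> #|T| <= card_set A.
Proof.
move=> finA injf fA; rewrite cardE -(size_map f) /card_set.
apply: uniq_leq_size; first by rewrite (map_inj_uniq injf) enum_uniq.
by move=> _ /mapP[x _ ->]; rewrite in_fset_set ?inE.
Qed.

Lemma card_set_le (T : finType) (U : choiceType) (f : T -> U) (A : set U) :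
  finite_set A -> (forall y, A y -> exists x, y = f x) -> card_set A <= #|T|.
Proof.
move=> finA Af; rewrite cardE -(size_map f) /card_set.
apply: uniq_leq_size => [|y]; first exact: fset_uniq.
rewrite in_fset_set // inE => /Af[x ->].
by rewrite map_f ?mem_enum.
Qed.

(** * Parity homomorphisms from the free group to Z/2 *)

Section Parity.
Local Open Scope group_scope.
Variable P : pred letter.
Hypothesis P_linv : forall x, P (linv x) = P x.

(** By [P_linv], a cancelling pair of letters contributes 0 or 2 to the count, so parity survives
    free reduction. *)
Lemma odd_count_push x w : odd (count P (push x w)) = P x (+) odd (count P w).
Proof.
case: w => [|y w] /=; first by rewrite addn0; case: (P x).
case: eqP => [->|_] /=; rewrite !oddD ?P_linv ?oddb //.
by rewrite addbA addbb.
Qed.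

Lemma odd_count_reduce w : odd (count P (reduce w)) = odd (count P w).
Proof. by elim: w => //= x w IHw; rewrite odd_count_push IHw oddD oddb. Qed.

Lemma odd_countM (g h : F2) :
  odd (count P (g * h)) = odd (count P g) (+) odd (count P h).
Proof. by rewrite odd_count_reduce count_cat oddD. Qed.

Lemma odd_countV (g : F2) : odd (count P g^-1) = odd (count P g).
Proof.
rewrite odd_count_reduce /winv count_rev count_map; congr odd.
exact: eq_count.
Qed.

Lemma odd_count_phi (u v g : F2) :
  ~~ odd (count P u) -> ~~ odd (count P v) -> ~~ odd (count P (phi u v g)).
Proof.
move=> evu evv; rewrite /phi /word_val.
elim: (word_of g) => [|x w IHw]; first by rewrite big_nil.
rewrite big_cons odd_countM (negPf IHw) addbF.
by case: x => [[] []]; rewrite /letter_val /= ?odd_countV.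
Qed.

(** A preimage of [gen_b] would force its count, which is 1, to be even. *)
Lemma even_not_automorphism (u v : F2) :
  P (false, false) -> ~~ odd (count P u) -> ~~ odd (count P v) ->
  ~ automorphism (phi u v).
Proof.
move=> Pb evu evv [f _ fK]; have := odd_count_phi (f gen_b) evu evv.
by rewrite fK /= Pb.
Qed.

End Parity.

(** * Endomorphisms that send b to a square *)

Section NonPrime.
Local Open Scope group_scope.

Lemma phi_square_comp (u w : F2) :
  phi u (w * w) =1 phi u w \o phi gen_a (gen_b * gen_b).
Proof.
move=> g /=; rewrite [RHS](phi_unique (phi u w \o phi gen_a (gen_b * gen_b))).
by rewrite /= phi_a phi_b phiM phi_a !phi_b.
Qed.

Lemma even_square_not_prime (u w : F2) :
  ~~ odd (size u) -> ~~ odd (size w) -> ~ prime_endo (phi u (w * w)).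
Proof.
move=> evu evw [_ /(_ _ _ (phi_square_comp u w))[]].
  by apply: (@even_not_automorphism predT); rewrite ?count_predT.
(* The words a and b^2 contain 0 and 2 letters b. *)
by apply: (@even_not_automorphism (fun x => ~~ x.1)).
Qed.

End NonPrime.

(** * Coding of reduced words *)

(* [option bool] indexes the three letters that may follow [x] in a reduced
   word; [word_from x s] is the tail, following [x], of the word coded by [s]. *)
Definition next (x : letter) (i : option bool) : letter :=
  if i is Some e then (~~ x.1, e) else x.

Fixpoint word_from (x : letter) (s : seq (option bool)) : seq letter :=
  if s is i :: s' then next x i :: word_from (next x i) s' else [::].

Lemma next_inj x : injective (next x).
Proof. by case: x => [[] []] [[]|] [[]|]. Qed.

Lemma next_linv x i : next x i != linv x.
Proof. by case: x i => [[] []] [[]|]. Qed.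

Lemma next_onto x y : y != linv x -> exists i, y = next x i.
Proof.
case: x y => [[] e] [[] e']; rewrite /linv /=.
- by move=> neq; exists None; case: e e' neq => [] [].
- by exists (Some e').
- by exists (Some e').
- by move=> neq; exists None; case: e e' neq => [] [].
Qed.

Lemma size_word_from x s : size (word_from x s) = size s.
Proof. by elim: s x => //= i s IHs x; rewrite IHs. Qed.

Lemma word_from_inj x : injective (word_from x).
Proof.
move=> s t; elim: s t x => [|i s IHs] [|j t] x //= [/next_inj <-].
by move/IHs ->.
Qed.

Lemma word_from_path x s : path (fun x y => y != linv x) x (word_from x s).
Proof. by elim: s x => //= i s IHs x; rewrite next_linv IHs. Qed.

Lemma word_from_onto x w :
  path (fun x y => y != linv x) x w -> exists s, w = word_from x s.
Proof.
elim: w x => [|y w IHw] x /=; first by exists [::].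
by case/andP=> /next_onto[i ->] /IHw[s ->]; exists (i :: s).
Qed.

Lemma reduced_word_from (g : F2) : exists x s, word_of g = word_from x s.
Proof.
case: g => [[|x w] redw] /=; first by exists (true, false), [::].
(* Since [next x None] is [x], a leading [None] writes the first letter itself, and the code is as
   long as the word. *)
by have /word_from_onto[s ->] := redw; exists x, (None :: s).
Qed.

(** * Upper bound for the square of the ball *)

Lemma sum_expn3 n : \sum_(i < n) 3 ^ i <= 3 ^ n.
Proof.
elim: n => [|n IHn]; first by rewrite big_ord0.
rewrite big_ord_recr /= expnS [3 * _]mulSn addnC leq_add2l.
by apply: leq_trans IHn _; rewrite leq_pmull.
Qed.

Lemma card_F2ball2 n :
  card_set (F2ball n `*` F2ball n)%classic <= 3 ^ (2 * n + 6).
Proof.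
pose code : finType := (letter * {bseq n of option bool})%type.
pose f (c : code) := F2_of (word_from c.1 c.2).
have ballf g : F2ball n g -> exists c, g = f c.
  rewrite F2ballE /= => le_gn; have [x [s Dg]] := reduced_word_from g.
  have les: size s <= n by rewrite -(size_word_from x) -Dg.
  by exists (x, Bseq les); rewrite /f /= -Dg F2_ofK.
apply: (@leq_trans #|{: code * code}|).
  apply: (@card_set_le _ _ (fun c => (f c.1, f c.2))).
    exact/finite_setX/finite_F2ball/finite_F2ball.
  by case=> g h [/= /ballf[c ->] /ballf[d ->]]; exists (c, d).
rewrite !card_prod !card_bool card_bseq card_option card_bool.
have -> : 3 ^ (2 * n + 6) = 3 ^ n.+3 * 3 ^ n.+3.
  by rewrite -expnD; congr (_ ^ _); lia.
(* The left side counts the codes: 4 starting letters times the sequences of length at most n. It is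
   at most 4 * 3^(n+1). *)
suff le1 : 2 * 2 * \sum_(i < n.+1) 3 ^ i <= 3 ^ n.+3 by rewrite leq_mul.
apply: leq_trans (leq_mul (leqnn _) (sum_expn3 n.+1)) _.
by rewrite [3 ^ n.+3]expnS [3 ^ n.+2]expnS mulnA leq_mul2r orbT.
Qed.

(** * Lower bound for the non-prime pairs *)

(* The last letter [close w] makes the square of [a :: rcons w (close w)]
   reduced. *)
Definition close (w : seq letter) : letter :=
  if last (true, false) w == (true, true) then (false, false)
  else last (true, false) w.

Definition root_word (s : seq (option bool)) : seq letter :=
  let w := word_from (true, false) s in (true, false) :: rcons w (close w).

Lemma size_root_word s : size (root_word s) = (size s).+2.
Proof. by rewrite /= size_rcons size_word_from. Qed.

Lemma root_word_inj : injective root_word.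
Proof. by move=> s t [/rcons_inj[/word_from_inj]]. Qed.

Lemma reduced_root_word2 s : reduced (root_word s ++ root_word s).
Proof.
rewrite /reduced /root_word /= cat_path last_rcons.
rewrite /= rcons_path word_from_path /= /close.
(* Two junctions remain: into the closing letter, and from it to the initial a of the second
   copy. *)
by case: (last _ _) => [[] []].
Qed.

Lemma reduced_root_word s : reduced (root_word s).
Proof. by have := reduced_root_word2 s; rewrite /reduced => /cat_sorted2[]. Qed.

(** Here [u] is a followed by 4m+3 free choices, and the root has length 2m+2 with 2m free choices.
    Both lengths are even, and the square has length 4m+4. *)
Lemma card_nonprime_pairs m :
  3 ^ (6 * m + 3) <= card_set (nonprime_pairs (4 * m.+1)).
Proof.
pose f (c : (4 * m + 3).-tuple (option bool) * (2 * m).-tuple (option bool)) :=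
  (F2_of ((true, false) :: word_from (true, false) c.1),
   F2mul (F2_of (root_word c.2)) (F2_of (root_word c.2))).
have word1 c : word_of (f c).1 = (true, false) :: word_from (true, false) c.1.
  by apply: reduce_id; apply: word_from_path.
have word2 c : word_of (f c).2 = root_word c.2 ++ root_word c.2.
  rewrite -[LHS]/(reduce (reduce (root_word c.2) ++ reduce (root_word c.2))).
  by rewrite !reduce_id ?reduced_root_word2 ?reduced_root_word.
suff <- : #|{: (4 * m + 3).-tuple (option bool)
               * (2 * m).-tuple (option bool)}| = 3 ^ (6 * m + 3).
  apply: (@card_set_ge _ _ f); first exact: finite_nonprime_pairs.
    move=> [s t] [s' t'] eq_f.
    have := congr1 (word_of \o fst) eq_f.
    rewrite [LHS]word1 [RHS]word1 => -[/word_from_inj eqs].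
    have := congr1 (word_of \o snd) eq_f.
    rewrite [LHS]word2 [RHS]word2 => /eqP.
    (* The roots have equal length, so equal squares have equal first halves. *)
    rewrite eqseq_cat ?size_root_word ?size_tuple //.
    move=> /andP[/eqP/root_word_inj eqt _].
    by congr (_, _); apply: val_inj.
  move=> c; split.
    rewrite F2ballE; split; rewrite /mkset.
      by rewrite word1 /= size_word_from size_tuple; lia.
    by rewrite word2 size_cat size_root_word size_tuple; lia.
  apply: even_square_not_prime.
    by rewrite word1 /= size_word_from size_tuple oddD oddM.
  by rewrite [word_of _]reduce_id ?reduced_root_word // size_root_word size_tuple
    /= oddM.
rewrite card_prod !card_tuple card_option card_bool -expnD.
by congr (_ ^ _); lia.
Qed.

(** * Passage to the limit superior *)

Local Open Scope ring_scope.

Lemma limn_esup_ge_frequently (R : realType) (u : nat -> \bar R) (l : R) :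
  (forall e n, 0 < e -> exists2 k, (n <= k)%N & ((l - e)%:E <= u k)%E) ->
  (l%:E <= limn_esup u)%E.
Proof.
move=> freq; rewrite limn_esup_lim; apply: lime_ge; first exact: is_cvg_esups.
apply: nearW => n; apply/lee_subgt0Pr => e /(freq e n)[k le_nk leu].
by apply: le_trans leu _; apply: ereal_sup_ubound; exists k.
Qed.

Lemma ln_card_ratio (R : realType) m :
  (6 * m%:R + 3) / (8 * m%:R + 14) <=
  ln ((card_set (nonprime_pairs (4 * m.+1)))%:R : R)
  / ln ((card_set (F2ball (4 * m.+1) `*` F2ball (4 * m.+1))%classic)%:R : R).
Proof.
set A := card_set (nonprime_pairs _); set B := card_set _.
have leA := card_nonprime_pairs m; rewrite -/A in leA.
have leB := card_F2ball2 (4 * m.+1); rewrite -/B in leB.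
(* This makes [B] at least [A], hence [ln B] positive, as division by it requires. *)
have leAB : (A <= B)%N.
  apply/fsubset_leq_card; rewrite -fset_set_sub; first by move=> uv [].
    exact: finite_nonprime_pairs.
  exact/finite_setX/finite_F2ball/finite_F2ball.
have l3 : 0 < ln (3 : R) by rewrite ln_gt0 ?ltr1n.
have lnX k : ln ((3 ^ k)%:R : R) = k%:R * ln 3.
  by rewrite natrX lnXn // mulr_natl.
have A0 : (0 < A)%N by apply: leq_trans leA; rewrite expn_gt0.
have lA : (6 * m + 3)%:R * ln 3 <= ln (A%:R : R).
  by rewrite -lnX ler_ln ?posrE ?ltr0n ?expn_gt0 ?ler_nat.
have lB : ln (B%:R : R) <= (2 * (4 * m.+1) + 6)%:R * ln 3.
  rewrite -lnX ler_ln ?posrE ?ltr0n ?expn_gt0 ?ler_nat //.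
  exact: leq_trans leAB.
have lAB : ln (A%:R : R) <= ln (B%:R : R).
  by rewrite ler_ln ?posrE ?ltr0n ?ler_nat // (leq_trans A0).
have lB0 : 0 < ln (B%:R : R).
  apply: lt_le_trans lAB; apply: lt_le_trans lA.
  by rewrite mulr_gt0 ?ltr0n ?addn_gt0 ?orbT.
rewrite ler_pdivlMr //.
have m0 : 0 <= m%:R :> R by rewrite ler0n.
rewrite natrD natrM in lA.
rewrite natrD !natrM -addn1 natrD in lB.
rewrite mulrAC ler_pdivrMr; last lra.
apply: le_trans (_ : (6 * m%:R + 3) * ((8 * m%:R + 14) * ln 3) <= _).
  rewrite ler_wpM2l; [by []|lra|].
  by apply: le_trans lB _; rewrite ler_pM2r //; lra.
rewrite mulrCA mulrC ler_pM2r //; lra.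
Qed.

Theorem theoremB (R : realType) : ((3 / 4)%R%:E <= delta_np R)%E.
Proof.
apply: limn_esup_ge_frequently => e n e_gt0.
(* The gap 3/4 - (6m+3)/(8m+14) equals 15/(16m+28), which is below 1/m and so below [e] once m >
   1/e. *)
pose m := (n + Num.bound e^-1)%N; exists (4 * m.+1)%N; first by rewrite /m; lia.
rewrite lee_fin; apply: le_trans (ln_card_ratio R m).
have lt_m : e^-1 < m%:R.
  apply: lt_le_trans (archi_boundP _) _; first by rewrite invr_ge0 ltW.
  by rewrite ler_nat leq_addl.
have m0 : 0 < m%:R :> R by apply: lt_trans lt_m; rewrite invr_gt0.
have em : 1 < e * m%:R by rewrite mulrC -ltr_pdivrMr // mul1r.
by rewrite ler_pdivlMr; nra.
Qed.
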